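(* Let $n\ge 2$ and $0\le k\le n$. The number of Boolean intervals of rank $k$ in the right weak order of the Coxeter group of type $C_n$ is $$2^{n-k}\, n!\binom{n+1-k}{k}.$$
   Context: Type $C_n$: generators $s_1,\ldots,s_n$ with $m(s_i,s_{i+1})=3$ for $i\le n-2$, $m(s_{n-1},s_n)=4$, $m(s_i,s_j)=2$ for $|i-j|>1$; it has order $2^n n!$. Right weak order: $u\le w$ iff $\ell(w)=\ell(u)+\ell(u^{-1}w)$. A Boolean interval of rank $k$ is an interval isomorphic to the lattice of subsets of a $k$-element set. *)

(* Defs.v *)
From HB Require Import structures.
From mathcomp Require Import all_boot all_fingroup.

Set Implicit Arguments.
Unset Strict Implicit.
Unset Printing Implicit Defensive.

Local Open Scope group_scope.

(* W is the group presented by the generators s i and the relations            *)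
(* (s i * s j) ^+ m i j = 1; the presentation is expressed by its universal    *)
(* property among all (possibly infinite) groups.  The involution relations    *)
(* are those with i = j, where m i i = 1.  As the s i are involutions, words   *)
(* in the s i alone, without inverses, suffice for generation.                 *)
Record coxeter_system (I : finType) (m : I -> I -> nat)
    (W : groupType) (s : I -> W) : Prop := CoxeterSystem {
  cox_gen : forall w : W, exists r : seq I, w = \prod_(i <- r) s i;
  cox_rel : forall i j : I, (s i * s j) ^+ m i j = 1;
  cox_univ : forall (H : groupType) (t : I -> H),
    (forall i j : I, (t i * t j) ^+ m i j = 1) ->
    exists f : {multiplicative W -> H}, forall i : I, f (s i) = t i
}.

(* The generator s_(i+1) of the usual numbering s_1, ..., s_n is indexed by    *)
(* i : 'I_n, so the bond labelled 4 joins the indices n - 2 and n - 1.         *)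
Definition coxeter_matrix_C (n : nat) (i j : 'I_n) : nat :=
  (if i == j then 1
  else if (i.+1 == j :> nat) || (j.+1 == i :> nat) then
    if maxn i j == n.-1 then 4 else 3
  else 2)%N.

Section WeakOrder.

Variables (I : finType) (m : I -> I -> nat) (W : finGroupType) (s : I -> W).
Hypothesis cs : coxeter_system m s.

Definition has_word (w : W) (l : nat) : bool :=
  [exists r : l.-tuple I, w == \prod_(i <- r) s i].

Lemma has_word_ex (w : W) : exists l, has_word w l.
Proof.
by have [r ->] := cox_gen cs w; exists (size r); apply/existsP; exists (in_tuple r).
Qed.

Definition coxeter_length (w : W) : nat := ex_minn (has_word_ex w).

Definition weak_le (u w : W) : bool :=
  coxeter_length w == (coxeter_length u + coxeter_length (u^-1 * w))%N.

Definition weak_interval (u v : W) : {set W} :=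
  [set x | weak_le u x && weak_le x v].

Definition is_boolean_interval (k : nat) (A : {set W}) : bool :=
  [exists u : W, exists v : W,
    [&& weak_le u v, A == weak_interval u v &
     [exists f : {ffun {set 'I_k} -> W},
       [&& injectiveb f, f @: [set: {set 'I_k}] == A &
        [forall X : {set 'I_k}, forall Y : {set 'I_k},
          (X \subset Y) == weak_le (f X) (f Y)]]]]].

Definition boolean_intervals (k : nat) : {set {set W}} :=
  [set A | is_boolean_interval k A].

End WeakOrder.

(* Main.v *)
Require Import Defs.
From mathcomp Require Import all_boot all_fingroup zify.

(* Letting W act on W * bool by s i : (x, b) |-> (s i x s i, b + [x = s i])    *)
(* yields a cocycle N with N (uv) = N u + u (N v) u^-1; N w is the set of left *)
(* inversions of w, it has l(w) elements, and the weak order is inclusion of   *)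
(* the sets N w.  A Boolean interval [u, v] then determines a set J of pairwise *)
(* commuting generators, the labels of the covers of u, with v = u * prod J,   *)
(* and conversely every such J with no descent of u in J gives one.  Since     *)
(* right multiplication by prod X, for X a subset of J, moves the descents in  *)
(* J from D to D + X, each J occurs for |W| / 2 ^ |J| elements u.  In type C   *)
(* the sets J are the sets of indices without two consecutive elements, and    *)
(* |W| = 2 ^ n n! by coset enumeration on one side and the action of signed    *)
(* permutations on the other.                                                  *)

Set Implicit Arguments.
Unset Strict Implicit.
Unset Printing Implicit Defensive.

(** The theorem is a double count of pairs (u, J), where J is a set of k pairwise commuting
    generators and u has no descent in J. Everything is read off inversion sets ([N_inj],
    [weak_leE]): passing from u to u * prod J adjoins exactly the k reflections u s_i u^-1, so the
    interval between them is a Boolean lattice ([boolean_interval_prod_gen]). Conversely, two atoms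
    of a Boolean interval have a join reached by two words of length two above u, which forces their
    labels to commute ([bool_prod_gen]). Each coset of the subgroup generated by J contributes one
    such u among its 2^k elements ([card_minimal]), so the number of intervals times 2^k is |W|
    times the number of commuting k-sets ([card_boolean_intervals]). In type C these are the
    k-subsets of a path without neighbours ([card_sparse_below]), and |W| = 2^n n!
    ([card_typeC]). *)

Section CoxeterSystems.

Local Open Scope group_scope.

Variables (I : finType) (m : I -> I -> nat) (W : finGroupType) (s : I -> W).
Hypothesis m_diag : forall i, m i i = 1%N.
Hypothesis cs : coxeter_system m s.

Lemma gen_sqr i : s i * s i = 1.
Proof. by have := cox_rel cs i i; rewrite m_diag expg1. Qed.

Lemma gen_invg i : (s i)^-1 = s i.
Proof. by apply/eqP; rewrite eq_invg_mul gen_sqr. Qed.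

Lemma gen_conjE x i : x ^ s i = s i * x * s i.
Proof. by rewrite conjgE gen_invg mulgA. Qed.

Lemma gen_conjj i : s i ^ s i = s i.
Proof. by rewrite gen_conjE gen_sqr mul1g. Qed.

Lemma gen_conjK i : involutive (conjg^~ (s i)).
Proof. by move=> x; rewrite /= -conjgM gen_sqr conjg1. Qed.

Lemma conjg_eq (x y u : W) : (x ^ u == y) = (x == y ^ u^-1).
Proof. exact: (canF_eq (conjgK u)). Qed.

Lemma gen_conj_eq x y i : (x ^ s i == y) = (x == y ^ s i).
Proof. by rewrite conjg_eq gen_invg. Qed.

(** * The signed action on reflections *)

Definition flip_fun i (x : W * bool) := (x.1 ^ s i, x.2 (+) (x.1 == s i)).

Lemma flip_funK i : involutive (flip_fun i).
Proof.
move=> [x b]; rewrite /flip_fun /= gen_conjK.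
by rewrite gen_conj_eq gen_conjj addbK.
Qed.

Definition flip_perm i : {perm W * bool} := perm (can_inj (flip_funK i)).

Lemma flip_permE i x b : flip_perm i (x, b) = (x ^ s i, b (+) (x == s i)).
Proof. by rewrite permE. Qed.

Lemma dihedral_swap i j k :
  s i * ((s i * s j) ^+ k)^-1 = (s i * s j) ^+ k * s i.
Proof.
elim: k => [|k IHk]; first by rewrite expg0 invg1 mulg1 mul1g.
rewrite {1}expgS invMg mulgA IHk expgSr invMg !gen_invg -!mulgA.
by rewrite [s i * (s j * s i)]mulgA.
Qed.

(** The bit is toggled once for each reflection equal to x among those met along the alternating
    word of length 2k. *)
Lemma flip_perm_expg i j k x b :
  ((flip_perm i * flip_perm j) ^+ k) (x, b) =
    (x ^ ((s i * s j) ^+ k),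
     b (+) \big[addb/false]_(l < k.*2) (x == (s i * s j) ^+ l * s i)).
Proof.
set c := s i * s j.
elim: k => [|k IHk]; first by rewrite !expg0 perm1 conjg1 big_ord0 addbF.
have ck_conj l : (c ^+ l * s i) ^ (c ^- k) = c ^+ (k + k + l) * s i.
  rewrite conjgE invgK -!mulgA dihedral_swap -/c !mulgA.
  by rewrite -!expgD; congr (c ^+ _ * _); lia.
rewrite expgSr permM IHk permM !flip_permE doubleS !big_ord_recr /=.
rewrite -!conjgM expgSr -/c mulgA -!addbA; congr (_, _ (+) (_ (+) (_ (+) _))).
  by have := ck_conj 0; rewrite expg0 mul1g addn0 addnn conjg_eq => ->.
rewrite conjgM gen_conj_eq conjg_eq gen_conjE -mulgA.
by have := ck_conj 1%N; rewrite expg1 addn1 addnn /c -!mulgA => ->.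
Qed.

(** Since (s i * s j) ^+ m i j = 1, the list of 2 m i j reflections runs twice through the same m i
    j ones, and the parities cancel. *)
Lemma flip_perm_rel i j : (flip_perm i * flip_perm j) ^+ m i j = 1.
Proof.
apply/permP => -[x b]; rewrite flip_perm_expg perm1 (cox_rel cs) conjg1.
rewrite -(big_mkord xpredT (fun l => x == (s i * s j) ^+ l * s i)) -addnn.
rewrite /= (big_cat_nat _ (n := m i j)) //= ?leq_addr //.
rewrite -{2}[m i j]add0n big_addn addnK.
under [X in _ (+) (_ (+) X)]eq_bigr => l _ do
  rewrite expgD (cox_rel cs) mulg1.
by rewrite addbb addbF.
Qed.

(* The reflection cocycle: [N w] is the set of left inversions of [w]. *)
Lemma inversion_cocycle_exists : exists N : W -> {set W},
  (forall i, N (s i) = [set s i]) /\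
  (forall u v x, (x \in N (u * v)) = (x \in N u) (+) (x ^ u \in N v)).
Proof.
have [f fs] := cox_univ cs flip_perm_rel.
have f1 : f 1 = 1 by apply: (mulgI (f 1)); rewrite -gmulfM !mulg1.
(* The toggling at x does not depend on the initial bit, so starting from [false] records it all. *)
have fE w x b : f w (x, b) = (x ^ w, b (+) (f w (x, false)).2).
  have [r ->] := cox_gen cs w; elim: r x b => [|i r IHr] x b.
    by rewrite big_nil f1 !perm1 conjg1 addbF.
  rewrite big_cons gmulfM fs !permM !flip_permE !(IHr _ (_ (+) _)) /=.
  by rewrite conjgM !addbA.
exists (fun w => [set x | (f w (x, false)).2]); split=> [i|u v x].
  by apply/setP => x; rewrite !inE fs flip_permE.
by rewrite !inE gmulfM permM (fE u) (fE v).
Qed.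

(** * Inversion sets, length and weak order *)

Variable N : W -> {set W}.
Hypothesis N_gen : forall i, N (s i) = [set s i].
Hypothesis N_mul : forall u v x,
  (x \in N (u * v)) = (x \in N u) (+) (x ^ u \in N v).

Notation len := (coxeter_length cs).
Notation le := (weak_le cs).

Lemma N1 : N 1 = set0.
Proof.
by apply/setP => x; have := N_mul 1 1 x; rewrite mulg1 conjg1 addbb inE.
Qed.

Lemma N_genM i w x : (x \in N (s i * w)) = (x == s i) (+) (x ^ s i \in N w).
Proof. by rewrite N_mul N_gen inE. Qed.

Lemma N_invM u v x : (x ^ u \in N (u^-1 * v)) = (x \in N u) (+) (x \in N v).
Proof. by rewrite -{2}[v](mulKVg u) (N_mul u) addKb. Qed.

Lemma len_word r : (len (\prod_(i <- r) s i) <= size r)%N.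
Proof.
rewrite /coxeter_length; case: ex_minnP => l _; apply.
by apply/existsP; exists (in_tuple r).
Qed.

Lemma len_wordP w : exists2 r, w = \prod_(i <- r) s i & size r = len w.
Proof.
rewrite /coxeter_length; case: ex_minnP => l /existsP[r /eqP -> _].
by exists r; rewrite ?size_tuple.
Qed.

(** Strong exchange: x is the conjugate of some letter by the prefix before it, and multiplying by x
    deletes that letter. *)
Lemma exchange r x : x \in N (\prod_(i <- r) s i) ->
  exists2 r', x * \prod_(i <- r) s i = \prod_(i <- r') s i & (size r' < size r)%N.
Proof.
elim: r x => [|i r IHr] x; first by rewrite big_nil N1 inE.
rewrite big_cons N_genM; case: eqP => [-> _|_ /= /IHr[r' def_r' lt_r']].
  by exists r => //; rewrite mulgA gen_sqr mul1g.
exists (i :: r') => //; rewrite big_cons -def_r' gen_conjE !mulgA gen_sqr.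
by rewrite mul1g.
Qed.

Lemma len_exchange w x : x \in N w -> (len (x * w) < len w)%N.
Proof.
have [r -> <-] := len_wordP w => /exchange[r' ->].
exact: leq_ltn_trans (len_word r').
Qed.

(** Along a reduced word each letter contributes a new inversion; a repetition would let
    [len_exchange] shorten the word. *)
Lemma card_N w : #|N w| = len w.
Proof.
have [k] := ubnP (len w); elim: k w => // k IHk w.
have [[|i r] def_w len_w] := len_wordP w.
  by move: len_w; rewrite /= def_w big_nil N1 cards0.
move=> lt_w; pose w' := \prod_(j <- r) s j.
have {def_w} def_w : w = s i * w' by rewrite def_w big_cons.
have lt_w' : (len w' < len w)%N by rewrite -len_w /= ltnS len_word.
have iN' : s i \notin N w'.
  by apply/negP => /len_exchange; rewrite -def_w ltnNge (ltnW lt_w').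
have -> : N w = s i |: (conjg^~ (s i)) @: N w'.
  apply/setP => x; rewrite def_w N_genM !inE.
  rewrite -[X in X \in _ @: _](gen_conjK i) (mem_imset _ _ (@conjg_inj _ _)).
  by case: eqP => [->|//]; rewrite gen_conjj (negPf iN').
rewrite cardsU1 -[X in X \notin _](gen_conjj i).
rewrite (mem_imset _ _ (@conjg_inj _ _)) iN' card_imset; last exact: conjg_inj.
rewrite IHk; last exact: leq_trans lt_w' _.
apply/eqP; rewrite add1n eqn_leq lt_w' /= def_w.
have [r' def_r' <-] := len_wordP w'.
by rewrite def_r' -(big_cons _ _ i r' xpredT) (len_word (i :: r')).
Qed.

(** By the cocycle rule, conjugation by u carries the symmetric difference of N u and N v onto N
    (u^-1 * v). *)
Lemma card_N_invM u v : len (u^-1 * v) = #|N u :\: N v| + #|N v :\: N u|.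
Proof.
rewrite -card_N -(card_preimset _ (@conjg_inj _ u)).
rewrite -cardsUI [X in _ = (_ + X)%N](_ : _ = 0%N) ?addn0; last first.
  by apply: eq_card0 => x; rewrite !inE; case: (x \in N u); rewrite ?andbF.
apply: eq_card => x; rewrite !inE N_invM.
by case: (x \in N u); case: (x \in N v).
Qed.

Lemma N_inj : injective N.
Proof.
move=> u v eqN; have [[|i r] def_r] := len_wordP (u^-1 * v).
  by move/eqP: def_r; rewrite big_nil -eq_mulVg1 => /eqP.
by rewrite card_N_invM eqN setDv cards0.
Qed.

Lemma weak_leE u v : le u v = (N u \subset N v).
Proof.
rewrite /weak_le card_N_invM -!card_N.
rewrite -(cardsID (N u) (N v)) -(cardsID (N v) (N u)) setIC.
by rewrite -setD_eq0 -cards_eq0; lia.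
Qed.


Lemma weak_le_anti u v : le u v -> le v u -> u = v.
Proof.
by rewrite !weak_leE => uv vu; apply: N_inj; apply/eqP; rewrite eqEsubset uv.
Qed.

Lemma weak_le_trans u v w : le u v -> le v w -> le u w.
Proof. by rewrite !weak_leE; apply: subset_trans. Qed.

Lemma weak_le_refl u : le u u.
Proof. by rewrite weak_leE. Qed.

(** The reflection u s_i u^-1 is the one that right multiplication by s_i adds to N u or removes
    from it. *)
Definition ascent u i := s i ^ u^-1 \notin N u.

Lemma N_Mgen u i : ascent u i -> N (u * s i) = s i ^ u^-1 |: N u.
Proof.
move=> asc; apply/setP=> x; rewrite N_mul N_gen !inE conjg_eq.
by case: eqP => [->|_]; rewrite ?addbF // (negPf asc).
Qed.

(** The label is the first letter of a reduced word of u^-1 * v: it is an inversion of that element,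
    and conjugating it back by u gives a member of N v outside N u. *)
Lemma weak_le_step u v : le u v -> u != v ->
  exists2 i, ascent u i & le (u * s i) v.
Proof.
rewrite weak_leE => /subsetP uv neq_uv.
have [[|i r] def_r len_r] := len_wordP (u^-1 * v).
  by case/eqP: neq_uv; apply/eqP; rewrite eq_mulVg1 def_r big_nil.
have: s i \in N (u^-1 * v).
  apply: contraT => iN; have /len_exchange: s i \in N (s i * (u^-1 * v)).
    by rewrite N_genM eqxx gen_conjj (negPf iN).
  rewrite mulgA gen_sqr mul1g -len_r def_r big_cons mulgA gen_sqr mul1g.
  by move=> /leq_trans/(_ (len_word r)) /=; lia.
rewrite -{1}(conjgKV u (s i)) N_invM.
case: (boolP (_ \in N u)) => [/uv -> //|asc /= iv]; exists i => //.
by rewrite weak_leE N_Mgen // subUset sub1set iv; apply/subsetP.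
Qed.

(** * Intervals spanned by commuting generators *)

Hypothesis s_inj : injective s.

Definition commuting (J : {set I}) :=
  [forall i in J, forall j in J, s i * s j == s j * s i].
(** For commuting J, this says that u is the shortest element of its coset modulo the subgroup
    generated by J. *)
Definition minimal u (J : {set I}) := [forall i in J, ascent u i].
Definition prod_gen (J : {set I}) := \prod_(i <- enum J) s i.

Lemma commutingP (J : {set I}) :
  reflect {in J &, forall i j, s i ^ s j = s i} (commuting J).
Proof.
apply: (iffP forall_inP) => [cJ i j iJ jJ | cJ i iJ].
  have /forall_inP/(_ j jJ)/eqP com := cJ i iJ.
  by rewrite gen_conjE -com -mulgA gen_sqr mulg1.
apply/forall_inP => j jJ; rewrite -[X in X * _ == _](cJ i j iJ jJ) gen_conjE.
by rewrite -mulgA gen_sqr mulg1.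
Qed.

Lemma sub_commuting (J K : {set I}) : J \subset K -> commuting K -> commuting J.
Proof.
move=> /subsetP JK /commutingP cK; apply/commutingP => i j /JK iK /JK jK.
exact: cK.
Qed.

Lemma conjg_prod_gen (X J : {set I}) i :
  commuting J -> X \subset J -> i \in J -> s i ^ prod_gen X = s i.
Proof.
move=> /commutingP cJ /subsetP XJ iJ; rewrite /prod_gen.
have: {subset enum X <= J} by move=> j; rewrite mem_enum; apply: XJ.
elim: (enum X) => [|j r IHr] rJ; first by rewrite big_nil conjg1.
rewrite big_cons conjgM (cJ _ _ iJ) ?rJ ?mem_head // IHr // => l lr.
by rewrite rJ // inE lr orbT.
Qed.

Lemma N_prod_gen J : commuting J -> N (prod_gen J) = s @: J.
Proof.
move/commutingP => cJ; rewrite /prod_gen.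
suff eqN x : (x \in N (\prod_(i <- enum J) s i)) = (x \in map s (enum J)).
  apply/setP=> x; rewrite eqN; apply/mapP/imsetP => -[i iJ ->]; exists i => //.
    by rewrite mem_enum in iJ.
  by rewrite mem_enum.
have: {subset enum J <= J} by move=> j; rewrite mem_enum.
elim: (enum J) (enum_uniq J) x => [|j r IHr] /= r_uniq x rJ.
  by rewrite big_nil N1 inE.
have /andP[jr {}r_uniq] := r_uniq.
have {}IHr y : (y \in N (\prod_(i <- r) s i)) = (y \in map s r).
  by apply: IHr => // l lr; rewrite rJ // inE lr orbT.
rewrite big_cons N_genM IHr inE.
have jJ : j \in J by rewrite rJ ?mem_head.
have {}rJ : {subset r <= J} by move=> l lr; rewrite rJ // inE lr orbT.
have -> : (x ^ s j \in map s r) = (x \in map s r).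
  apply/mapP/mapP => -[l lr def_x]; exists l => //.
    by apply: (conjg_inj (s j)); rewrite def_x cJ // rJ.
  by rewrite def_x cJ // rJ.
by case: eqP => [->|//]; rewrite mem_map // (negPf jr).
Qed.

Lemma N_Mprod_gen u J : commuting J -> minimal u J ->
  N (u * prod_gen J) = N u :|: [set s i ^ u^-1 | i in J].
Proof.
move=> cJ /forall_inP uJ; apply/setP=> x; rewrite N_mul N_prod_gen // inE.
have -> : (x ^ u \in s @: J) = (x \in [set s i ^ u^-1 | i in J]).
  apply/imsetP/imsetP => -[i iJ def_x]; exists i => //.
    by rewrite -def_x conjgK.
  by rewrite def_x conjgKV.
by case: imsetP => [[i /uJ asc ->]|_]; rewrite ?addbF ?orbF // orbT (negPf asc).
Qed.

Lemma sub_minimal (J K : {set I}) u : J \subset K -> minimal u K -> minimal u J.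
Proof.
by move=> /subsetP JK /forall_inP uK; apply/forall_inP => i /JK; apply: uK.
Qed.

Lemma conj_gen_inj u : injective (fun i => s i ^ u^-1).
Proof. by move=> i j /conjg_inj/s_inj. Qed.

Section MinimalRepresentative.

Variables (u : W) (J : {set I}).
Hypotheses (cJ : commuting J) (uJ : minimal u J).

Lemma weak_le_prod_gen (X Y : {set I}) : X \subset J -> Y \subset J ->
  le (u * prod_gen X) (u * prod_gen Y) = (X \subset Y).
Proof.
move=> XJ YJ; rewrite weak_leE !N_Mprod_gen ?(sub_commuting _ cJ) ?(sub_minimal _ uJ) //.
rewrite subUset subsetUl /=; apply/subsetP/subsetP => [sub i iX | sub x].
  have := sub _ (imset_f _ iX); rewrite inE (mem_imset _ _ (@conj_gen_inj u)).
  by case/orP => // iN; have /forall_inP/(_ i (subsetP XJ i iX)) := uJ; rewrite /ascent iN.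
by case/imsetP=> i /sub iY ->; rewrite inE (mem_imset _ _ (@conj_gen_inj u)) iY orbT.
Qed.

Lemma weak_le_Mprod_gen : le u (u * prod_gen J).
Proof. by rewrite weak_leE N_Mprod_gen // subsetUl. Qed.

(** An element between the two ends has as inversions N u and some of the adjoined reflections; by
    [N_inj] it is determined by which ones. *)
Lemma weak_interval_prod_gen :
  weak_interval cs u (u * prod_gen J) =
    [set u * prod_gen X | X : {set I} in powerset J].
Proof.
apply/setP=> x; rewrite inE; apply/andP/imsetP => [[ux xv] | [X]].
  pose X := [set i in J | s i ^ u^-1 \in N x].
  have XJ : X \subset J by apply/subsetP => i /setIdP[].
  exists X; first by rewrite powersetE.
  apply: N_inj; rewrite N_Mprod_gen ?(sub_commuting _ cJ) ?(sub_minimal _ uJ) //.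
  move: ux xv; rewrite !weak_leE N_Mprod_gen // => /subsetP ux /subsetP xv.
  apply/setP=> y; rewrite inE; apply/idP/orP => [yx|[/ux//|/imsetP[i]]].
    have /setUP[|/imsetP[i iJ def_y]] := xv _ yx; first by left.
    by right; apply/imsetP; exists i; rewrite // inE iJ -def_y.
  by rewrite inE => /andP[_ ?] ->.
rewrite powersetE => XJ ->; rewrite weak_le_prod_gen //; split=> //.
by rewrite weak_leE N_Mprod_gen ?(sub_commuting _ cJ) ?(sub_minimal _ uJ) ?subsetUl.
Qed.

Lemma boolean_interval_prod_gen :
  is_boolean_interval cs #|J| (weak_interval cs u (u * prod_gen J)).
Proof.
have gJ (X : {set 'I_#|J|}) : enum_val @: X \subset J.
  by apply/subsetP => _ /imsetP[j _ ->]; apply: enum_valP.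
have le_f (X Y : {set 'I_#|J|}) :
    (X \subset Y) = le (u * prod_gen (enum_val @: X)) (u * prod_gen (enum_val @: Y)).
  rewrite weak_le_prod_gen ?gJ //; apply/idP/idP => [/imsetS //|/subsetP sub].
  apply/subsetP => j /(imset_f enum_val)/sub.
  by rewrite (mem_imset _ _ enum_val_inj).
apply/existsP; exists u; apply/existsP; exists (u * prod_gen J).
rewrite weak_le_Mprod_gen eqxx /=; apply/existsP.
exists [ffun X : {set 'I_#|J|} => u * prod_gen (enum_val @: X)].
apply/and3P; split.
- apply/injectiveP => X Y; rewrite !ffunE => eqXY; apply/eqP.
  by rewrite eqEsubset !le_f eqXY weak_le_refl.
- rewrite weak_interval_prod_gen; apply/eqP/setP => x.
  apply/imsetP/imsetP => [[X _ ->]|[X]]; rewrite ?powersetE.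
    by exists (enum_val @: X); rewrite ?ffunE ?powersetE ?gJ.
  move=> XJ ->; exists [set j | enum_val j \in X]; rewrite ?inE // ffunE.
  congr (_ * prod_gen _); apply/setP => i; apply/idP/imsetP => [iX|[j]].
    have iJ := subsetP XJ i iX.
    by exists (enum_rank_in iJ i); rewrite ?inE enum_rankK_in.
  by rewrite inE => jX ->.
- by apply/'forall_forallP => X Y; rewrite !ffunE le_f.
Qed.

End MinimalRepresentative.

Lemma card_N_Mgen u i : ascent u i -> #|N (u * s i)| = #|N u|.+1.
Proof. by move=> asc; rewrite N_Mgen // cardsU1 [_ \notin _]asc. Qed.

(* Both [s i] and [s j] are inversions of the common value [z], so that        *)
(* [z = s j * s i] and [z = s i * s j].                                        *)
Lemma length_two_commute i j a b : i != j -> s i * s a = s j * s b ->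
  s i * s a != 1 -> s j * s i = s i * s j.
Proof.
move=> neq_ij eq_z z1.
have lastE i' j' a' b' : i' != j' -> s i' * s a' = s j' * s b' ->
    s j' * s b' != 1 -> s i' * s a' = s j' * s i'.
  move=> neq eqz zn1.
  have: s j' \in N (s i' * s a').
    rewrite eqz N_genM eqxx gen_conjj N_gen inE.
    by apply: contra zn1 => /eqP <-; rewrite gen_sqr.
  rewrite N_genM (inj_eq s_inj) eq_sym (negPf neq) N_gen inE => /eqP <-.
  by rewrite gen_conjE !mulgA gen_sqr mul1g.
have <- : s i * s a = s j * s i by apply: (lastE i j a b); rewrite // -eq_z.
by rewrite eq_z; apply: (lastE j i b a); rewrite // eq_sym.
Qed.

(** * From a Boolean interval to its labels *)

Section BooleanInterval.

Variables (k : nat) (u v : W) (f : {set 'I_k} -> W).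
Hypotheses (uv : le u v) (f_inj : injective f).
Hypothesis f_im : forall x, reflect (exists X, x = f X) (le u x && le x v).
Hypothesis f_le : forall X Y : {set 'I_k}, (X \subset Y) = le (f X) (f Y).

Lemma bool_mem X : le u (f X) && le (f X) v.
Proof. by apply/f_im; exists X. Qed.

Lemma bool_bot : f set0 = u.
Proof.
have /f_im[X def_u] : le u u && le u v by rewrite weak_le_refl.
apply: weak_le_anti; first by rewrite def_u -f_le sub0set.
by have /andP[] := bool_mem set0.
Qed.

Lemma bool_top : f setT = v.
Proof.
have /f_im[X def_v] : le u v && le v v by rewrite weak_le_refl uv.
apply: weak_le_anti; last by rewrite def_v -f_le subsetT.
by have /andP[] := bool_mem setT.
Qed.

(** A weak-order step from f X towards f (j |: X) stays in the interval, hence is some f Y with Y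
    inside j |: X; if Y missed j, the step would not increase length. *)
Lemma bool_step (X : {set 'I_k}) j : j \notin X ->
  exists2 i, ascent (f X) i & f (j |: X) = f X * s i.
Proof.
move=> jX; have le_jX : le (f X) (f (j |: X)) by rewrite -f_le subsetUr.
have neq_jX : f X != f (j |: X).
  by rewrite (inj_eq f_inj); apply: contraNneq jX => ->; rewrite setU11.
have [i asc le_i] := weak_le_step le_jX neq_jX; exists i => //.
have lt_i : le (f X) (f X * s i) by rewrite weak_leE N_Mgen // subsetUr.
have /andP[uX _] := bool_mem X; have /andP[_ jv] := bool_mem (j |: X).
have /f_im[Y def_Y] : le u (f X * s i) && le (f X * s i) v.
  by rewrite (weak_le_trans uX) // (weak_le_trans le_i).
rewrite def_Y; congr f; apply/eqP; rewrite eqEsubset andbC.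
rewrite f_le -def_Y le_i /= subUset sub1set f_le -def_Y lt_i andbT.
apply: contraT => jY.
have YX : Y \subset X.
  apply/subsetP => l lY; have: l \in j |: X.
    by apply: (subsetP _ l lY); rewrite f_le -def_Y.
  by case/setU1P => // def_l; rewrite -def_l lY in jY.
have: le (f X * s i) (f X) by rewrite def_Y -f_le.
move=> /(weak_le_anti lt_i)/(congr1 (fun w => #|N w|)).
by rewrite card_N_Mgen //; lia.
Qed.

Lemma bool_card (X : {set 'I_k}) : #|N (f X)| = (#|N u| + #|X|)%N.
Proof.
have [l] := ubnP #|X|; elim: l X => // l IHl X.
case: (set_0Vmem X) => [-> _|[j jX]]; first by rewrite bool_bot cards0 addn0.
rewrite (cardsD1 j X) jX add1n ltnS => lt_l.
have jXj : j \notin X :\ j by rewrite !inE eqxx.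
have [i asc def_f] := bool_step jXj.
by rewrite -{1}(setD1K jX) def_f card_N_Mgen // IHl // addnS.
Qed.

Lemma bool_prod_gen :
  exists J, [/\ commuting J, minimal u J, #|J| = k & v = u * prod_gen J].
Proof.
have /fin_all_exists2[g g_asc fg] (j : 'I_k) :
    exists2 i, ascent u i & f [set j] = u * s i.
  by have := @bool_step set0 j; rewrite inE setU0 bool_bot; apply.
have g_inj : injective g.
  by move=> i j eq_g; apply/set1_inj/f_inj; rewrite !fg eq_g.
have g_comm i j : s (g i) * s (g j) = s (g j) * s (g i).
  have [->//|neq_ij] := eqVneq i j.
  have /bool_step[a _ def_a] : j \notin [set i] by rewrite inE eq_sym.
  (* The join of the atoms i and j is reached from either of them, giving two words of length two
     for one element. *)
  have /bool_step[b _ def_b] : i \notin [set j] by rewrite inE.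
  have := def_b; rewrite [i |: [set j]]setUC def_a !fg -!mulgA => /mulgI eq_ab.
  apply/esym/(length_two_commute _ eq_ab); first by rewrite (inj_eq g_inj).
  apply/eqP => ab1; move: def_a; rewrite fg -mulgA ab1 mulg1 -bool_bot.
  by move/f_inj/setP/(_ j); rewrite !inE eqxx.
have cJ : commuting [set g j | j : 'I_k].
  apply/forall_inP => _ /imsetP[i _ ->]; apply/forall_inP => _ /imsetP[j _ ->].
  by rewrite g_comm.
have uJ : minimal u [set g j | j : 'I_k].
  by apply/forall_inP => _ /imsetP[i _ ->].
exists [set g j | j : 'I_k]; split=> //; first by rewrite card_imset // card_ord.
(* Every inversion of u * prod J comes from u or an atom below v, and both inversion sets have l(u)
   + k elements by [bool_card]. *)
apply: N_inj; apply/esym/eqP; rewrite eqEcard N_Mprod_gen //; apply/andP; split.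
  rewrite subUset -weak_leE uv; apply/subsetP => x /imsetP[_ /imsetP[j _ ->] ->].
  have : N (f [set j]) \subset N v by rewrite -weak_leE; case/andP: (bool_mem [set j]).
  by move/subsetP; apply; rewrite fg N_Mgen // setU11.
rewrite -bool_top bool_card cardsT card_ord cardsU disjoint_setI0 ?cards0 ?subn0.
  by rewrite leq_add2l card_imset ?card_imset ?card_ord //; apply: conj_gen_inj.
rewrite -setI_eq0 -subset0; apply/subsetP => x /setIP[xN /imsetP[i iJ def_x]].
by have /forall_inP/(_ i iJ) := uJ; rewrite /ascent -def_x xN.
Qed.

End BooleanInterval.

(** * Counting the pairs (u, J) *)

Definition boolean_data k : {set W * {set I}} :=
  [set p | [&& commuting p.2, #|p.2| == k & minimal p.1 p.2]].

Lemma boolean_intervalsE k :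
  boolean_intervals cs k =
    [set weak_interval cs p.1 (p.1 * prod_gen p.2) | p in boolean_data k].
Proof.
apply/setP => A; rewrite inE; apply/idP/imsetP => [|[[u J]]]; last first.
  rewrite inE /= => /and3P[cJ /eqP <- uJ ->].
  exact: boolean_interval_prod_gen.
case/existsP => u /existsP[v /and3P[uv /eqP -> /existsP[f /and3P[/injectiveP f_inj]]]].
move=> /eqP f_im /'forall_'forall_eqP f_le.
have [|J [cJ uJ sJ def_v]] := bool_prod_gen uv f_inj _ f_le.
  move=> x; apply: (iffP idP) => [ux|[X ->]].
    have : x \in weak_interval cs u v by rewrite inE.
    by rewrite -f_im => /imsetP[X _ ->]; exists X.
  have: f X \in weak_interval cs u v by rewrite -f_im imset_f ?inE.
  by rewrite inE.
by exists (u, J); rewrite /= ?def_v // inE /= cJ sJ eqxx uJ.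
Qed.

Lemma weak_interval_inj u v u' v' : le u v -> le u' v' ->
  weak_interval cs u v = weak_interval cs u' v' -> u = u' /\ v = v'.
Proof.
move=> uv uv' /setP eqI.
have := eqI u; have := eqI v; have := eqI u'; have := eqI v'.
rewrite !inE !weak_le_refl uv uv' /= => /andP[uv'' le1] /andP[le2 _].
by move=> /esym/andP[_ le3] /esym/andP[le4 _]; split; apply: weak_le_anti.
Qed.

Lemma card_boolean_intervals_data k :
  #|boolean_intervals cs k| = #|boolean_data k|.
Proof.
rewrite boolean_intervalsE card_in_imset // => -[u J] [u' J'].
rewrite !inE /= => /and3P[cJ _ uJ] /and3P[cJ' _ uJ'].
move/weak_interval_inj; rewrite !weak_le_Mprod_gen // => /(_ isT isT)[<-].
move/mulgI/(congr1 N); rewrite !N_prod_gen // => /(imset_inj s_inj) -> //.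
Qed.

(** Right multiplication by prod X changes the descent set D u within J to its symmetric difference
    with X, so the fibres of D over the 2 ^ #|J| subsets of J have equal size. *)
Lemma card_minimal (J : {set I}) : commuting J ->
  (#|[set u | minimal u J]| * 2 ^ #|J|)%N = #|W|.
Proof.
move=> cJ; pose D u := [set i in J | ~~ ascent u i].
have DM u (X : {set I}) : X \subset J -> D (u * prod_gen X) = (D u :\: X) :|: (X :\: D u).
  move=> XJ; have cX := sub_commuting XJ cJ.
  apply/setP => i; rewrite !inE; case iJ: (i \in J); rewrite /= ?andbF; last first.
    by apply/esym/negbTE; apply: contraFN iJ => /(subsetP XJ).
  rewrite /ascent !negbK N_mul N_prod_gen //.
  have -> : s i ^ (u * prod_gen X)^-1 = s i ^ u^-1.
    rewrite invMg conjgM; congr (_ ^ _); apply: (conjg_inj (prod_gen X)).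
    by rewrite conjgKV (conjg_prod_gen cJ).
  rewrite conjgKV (mem_imset _ _ s_inj); case: (_ \in N u); case: (i \in X) => //=.
have cardD (X : {set I}) : X \in powerset J -> #|[set u | D u == X]| = #|[set u | D u == set0]|.
  rewrite powersetE => XJ; have inj_X := @mulIg W (prod_gen X).
  apply/eqP; rewrite eqn_leq; apply/andP; split.
    rewrite -(card_imset [set u | D u == X] inj_X).
    apply/subset_leq_card/subsetP => x /imsetP[u]; rewrite inE => /eqP Du ->.
    by rewrite inE DM // Du !setDv setU0.
  rewrite -(card_imset [set u | D u == set0] inj_X).
  apply/subset_leq_card/subsetP => x /imsetP[u]; rewrite inE => /eqP Du ->.
  by rewrite inE DM // Du set0D setD0 set0U.
rewrite -[RHS]sum1_card (partition_big D (mem (powerset J))) /=; last first.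
  by move=> u _; rewrite powersetE; apply/subsetP => i /setIdP[].
under eq_bigr => X XJ do rewrite sum1_card -cardsE cardD //.
rewrite sum_nat_const card_powerset mulnC; congr (_ * _)%N.
apply: eq_card => u; rewrite !inE.
apply/forall_inP/eqP => [uJ|D0 i iJ].
  apply/setP => i; rewrite !inE; apply/negP => /andP[/uJ ->] //.
by apply: contraT => asc; have := in_set0 i; rewrite -D0 inE iJ asc.
Qed.

Lemma card_boolean_data k :
  (#|boolean_data k| * 2 ^ k)%N =
    (#|[set J | commuting J & #|J| == k]| * #|W|)%N.
Proof.
rewrite -[X in (X * _)%N]sum1_card.
rewrite (partition_big snd (mem [set J | commuting J & #|J| == k])) /=; last first.
  by move=> [u J]; rewrite !inE /= => /and3P[-> ->].
rewrite big_distrl /= -sum_nat_const; apply: eq_bigr => J.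
rewrite inE => /andP[cJ /eqP sJ]; rewrite -(card_minimal cJ) sJ; congr (_ * _)%N.
rewrite sum1_card -(card_imset [set u | minimal u J] (f := pair^~ J)) => [|x y []] //.
apply: eq_card => -[u K]; rewrite [LHS]unfold_in /= inE /=; apply/idP/imsetP => [|[u']].
  by case/andP=> /and3P[_ _ uK] /eqP <-; exists u; rewrite ?inE.
by rewrite inE => uJ [-> ->]; rewrite cJ sJ uJ !eqxx.
Qed.

Lemma card_boolean_intervals k :
  (#|boolean_intervals cs k| * 2 ^ k)%N =
    (#|[set J | commuting J & #|J| == k]| * #|W|)%N.
Proof. by rewrite card_boolean_intervals_data card_boolean_data. Qed.

End CoxeterSystems.

(** * Subsets of a path without neighbours *)

Section SparseSets.

Variable N : nat.

Definition sparse (J : {set 'I_N}) := [forall i in J, forall j in J, i.+1 != j].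

(** The bound n is separate from the ambient ['I_N], so that the recursion on n stays within one
    type. *)
Definition sparse_below n k : {set {set 'I_N}} :=
  [set J : {set 'I_N} | [&& [forall i in J, i < n], sparse J & #|J| == k]].

Lemma sparse_belowP n k (J : {set 'I_N}) :
  reflect [/\ forall i, i \in J -> i < n,
              {in J &, forall i j : 'I_N, i.+1 <> j} & #|J| = k]
    (J \in sparse_below n k).
Proof.
rewrite inE; apply: (iffP and3P) => [[/forall_inP Jn /forall_inP J2 /eqP kJ]|].
  by split=> // i j /J2/forall_inP J2' /J2'/eqP.
move=> [Jn J2 kJ]; split; [exact/forall_inP| |exact/eqP].
by apply/forall_inP => i iJ; apply/forall_inP => j jJ; apply/eqP; apply: J2.
Qed.

(** Split on membership of n: if it belongs to J, then n - 1 does not, and removing n leaves a set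
    below n - 1. Truncation of [n.-1] at 0 is harmless. *)
Lemma card_sparse_belowS n k : n < N ->
  #|sparse_below n.+1 k.+1| = #|sparse_below n k.+1| + #|sparse_below n.-1 k|.
Proof.
move=> ltnN; pose x := Ordinal ltnN.
pose X := [set J : {set 'I_N} | x \notin J].
have inX J : (J \in X) = (x \notin J) by rewrite inE.
rewrite -(cardsID X); congr (_ + _).
  apply: eq_card => J; rewrite in_setI inX.
  apply/andP/sparse_belowP => [[/sparse_belowP[Jn J2 kJ] xJ]|[Jn J2 kJ]].
    split=> // i iJ; have := Jn i iJ; rewrite ltnS leq_eqVlt => /predU1P[ix|//].
    by rewrite (_ : x = i) ?iJ // in xJ; apply: val_inj.
  split; last by apply/negP => /Jn; rewrite ltnn.
  by apply/sparse_belowP; split=> // i /Jn/leqW.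
have xJ J : J \in sparse_below n.-1 k -> x \notin J.
  by move=> /sparse_belowP[Jn _ _]; apply/negP => /Jn /=; lia.
rewrite -(card_in_imset (f := fun J => x |: J) (D := mem (sparse_below n.-1 k))).
  apply: eq_card => J; rewrite in_setD inX negbK.
  apply/andP/imsetP => [[xJ' /sparse_belowP[Jn J2 kJ]]|[K K_in ->]].
    exists (J :\ x); last by rewrite setD1K.
    apply/sparse_belowP; split.
    - move=> i /setD1P[ix iJ]; have := J2 i x iJ xJ'; have := Jn i iJ.
      by move: ix; rewrite -val_eqE /=; lia.
    - by move=> i j /setD1P[_ iJ] /setD1P[_ jJ]; apply: J2.
    by move: kJ; rewrite (cardsD1 x) xJ' => -[].
  split; first exact: setU11.
  have xK := xJ K K_in; have /sparse_belowP[Kn K2 kK] := K_in.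
  apply/sparse_belowP; split; last by rewrite cardsU1 xK kK.
    by move=> i /setU1P[->|/Kn] //=; lia.
  move=> i j /setU1P[->|iK] /setU1P[->|jK] /=; [lia | | |exact: K2].
    by have := Kn j jK; lia.
  by have := Kn i iK; lia.
by move=> J K /xJ xJ' /xJ xK eqJK; rewrite -(setU1K xJ') eqJK setU1K.
Qed.

Lemma card_sparse_below n k : n <= N -> #|sparse_below n k| = 'C(n.+1 - k, k).
Proof.
have [b] := ubnP n; elim: b n k => // b IHb n [|k] ltnb leqnN.
  rewrite bin0 -(cards1 (set0 : {set 'I_N})); apply: eq_card => J; rewrite [in RHS]inE.
  apply/sparse_belowP/eqP => [[_ _ /cards0_eq //]|->].
  by rewrite cards0; split=> // i; rewrite ?inE // => j; rewrite inE.
case: n => [|n] in ltnb leqnN *.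
  rewrite bin_small; last by lia.
  apply: eq_card0 => J; apply/sparse_belowP => -[J0 _ kJ].
  suff J_0: J = set0 by rewrite J_0 cards0 in kJ.
  by apply/setP => i; rewrite inE; apply/negP => /J0.
rewrite card_sparse_belowS // !IHb; try lia.
case: n => [|n] in ltnb leqnN *; first by case: k => [|[|k]].
(* Pascal's rule applies while the subtractions are not truncated; beyond that all the binomials
   vanish. *)
have [lekn|ltnk] := leqP k n.+1.
  by rewrite /= subSS subSS [in RHS]subSn // binS.
by rewrite !bin_small; lia.
Qed.

End SparseSets.

(** * Upper bound for the order by coset enumeration *)

Section UpperBound.

Local Open Scope group_scope.

Variables (W : finGroupType) (t : nat -> W) (n : nat).
Hypothesis tt : forall i, (i < n)%N -> t i * t i = 1.
Hypothesis t_comm : forall i j, (i.+1 < j < n)%N -> t i * t j = t j * t i.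
Hypothesis t_braid : forall i, (0 < i)%N -> (i.+1 < n)%N ->
  t i * t i.+1 * t i = t i.+1 * t i * t i.+1.
Hypothesis t_braid4 : (1 < n)%N -> t 0 * t 1 * t 0 * t 1 = t 1 * t 0 * t 1 * t 0.

Definition parab k : {group W} := <<[set t i | i : 'I_k]>>.

Lemma mem_parab k i : (i < k)%N -> t i \in parab k.
Proof. by move=> ltik; rewrite mem_gen // (imset_f _ (x := Ordinal ltik)). Qed.

(* With [t 0] at the end of the diagram carrying the bond 4, the elements       *)
(* [t j ... t k] for [0 < j <= k.+1] and [t j ... t 1 t 0 t 1 ... t k] for       *)
(* [j <= k] represent the left cosets of [parab k] in [parab k.+1].              *)
Fixpoint down j d := if d is d'.+1 then t j * down j.+1 d' else 1.

Fixpoint up j x := if j is j'.+1 then t j * up j' x else x.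

Lemma down_far i j d : (i.+1 < j)%N -> (j + d <= n)%N ->
  t i * down j d = down j d * t i.
Proof.
elim: d j => [|d IHd] j /= ltij lejn; first by rewrite mulg1 mul1g.
by rewrite mulgA t_comm ?(leq_trans _ lejn) -?mulgA ?IHd //; lia.
Qed.

(** The first hypothesis keeps the bond 4 between [t 0] and [t 1] out of the braid move. *)
Lemma down_near i j d : (0 < j)%N || (j.+1 < i)%N -> (j < i < j + d)%N -> (j + d <= n)%N ->
  t i * down j d = down j d * t i.-1.
Proof.
elim: d j => [|d IHd] j /= j0 lti len; first by lia.
have [def_i|neqi] := eqVneq i j.+1.
  subst i; case: d IHd len lti => [|d] _ len lti /=; first by lia.
  have j_gt0 : (0 < j)%N by lia.
  rewrite !mulgA -t_braid //; last by lia.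
  by rewrite -!mulgA down_far //; lia.
rewrite mulgA -t_comm; last by lia.
by rewrite -!mulgA IHd //; lia.
Qed.

Lemma up_far i j x : (j.+1 < i < n)%N -> t i * up j x = up j (t i * x).
Proof.
elim: j => [|j IHj] //= lti; rewrite mulgA -t_comm; last by lia.
by rewrite -mulgA IHj //; lia.
Qed.

Lemma upM j x y : up j (x * y) = up j x * y.
Proof. by elim: j => [|j IHj] //=; rewrite IHj mulgA. Qed.

(** A braid move raises the index to i.+1 on the ascending part, and [down_near] lowers it back to
    i; for i = 0 the bond 4 relation does both at once. *)
Lemma up_near i j k : (i < j <= k)%N -> (k < n)%N ->
  t i * up j (down 0 k.+1) = up j (down 0 k.+1) * t i.
Proof.
elim: j => [|j IHj] // ltij ltkn; have [eq_ij|neq_ij] := eqVneq i j; last first.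
  by rewrite mulgA t_comm -?mulgA ?IHj //; lia.
subst i; case: j IHj ltij => [|j] _ lti.
  case: k lti ltkn => [|k] // _ ltkn; rewrite [down 0 _]/= [up 1 _]/=.
  by rewrite !mulgA t_braid4 -?mulgA ?down_far //; lia.
have := @down_near j.+2 0 k.+1; set D := down 0 k.+1 => nearD.
rewrite /= !mulgA t_braid; [|lia..].
rewrite -!mulgA up_far; last by lia.
by rewrite nearD ?upM ?mulgA //; lia.
Qed.

Definition coset_rep k (p : bool * 'I_k.+1) :=
  if p.1 then up p.2 (down 0 k.+1) else down p.2.+1 (k - p.2).

(** The cosets form a path, from (false, k) down to (false, 0), then (true, 0) up to (true, k); each
    generator either moves along an edge or fixes the coset. *)
Lemma coset_rep_step k i (p : bool * 'I_k.+1) : (k < n)%N -> (i <= k)%N ->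
  exists q : bool * 'I_k.+1, exists2 g, g \in parab k &
    t i * coset_rep p = coset_rep q * g.
Proof.
case: p => b [j ltjk] ltkn leik.
suff [b' [j' [g [lej'k gk eqg]]]] : exists b' j' g, [/\ (j' < k.+1)%N, g \in parab k &
    t i * (if b then up j (down 0 k.+1) else down j.+1 (k - j)) =
    (if b' then up j' (down 0 k.+1) else down j'.+1 (k - j')) * g].
  by exists (b', Ordinal lej'k), g.
have tti : t i * t i = 1 by apply: tt; lia.
have [ltij|ltji|eq_ij] := ltngtP i j.
- exists b, j, (t i); split; [by []|by apply: mem_parab; lia|].
  by case: b; [rewrite up_near // | rewrite down_far //]; lia.
- have [eq_ij|neq_ij] := eqVneq i j.+1.
    subst i; exists b, j.+1, 1; split; [by []|exact: group1|rewrite mulg1].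
    case: b => //; rewrite -(subnSK leik).
    by rewrite [down j.+1 _]/= mulgA tti mul1g.
  exists b, j, (t i.-1); split; [by []|by apply: mem_parab; lia|].
  case: b; last by rewrite down_near //; lia.
  by rewrite up_far ?down_near ?upM //; lia.
- subst j; case: b; case: i => [|i] in tti leik ltjk *.
  + by exists false, 0%N, 1; rewrite group1 mulg1 subn0 /= mulgA tti mul1g.
  + exists true, i, 1; rewrite group1 mulg1 /= mulgA tti mul1g.
    by split=> //; apply: ltnW.
  + by exists true, 0%N, 1; rewrite group1 mulg1 subn0.
  exists false, i, 1; rewrite group1 mulg1 -(subnSK leik) /=.
  by split=> //; apply: ltnW.
Qed.

(** The union U of the listed cosets contains 1 and is stable under left multiplication by the
    generators. *)
Lemma card_parabS k : (k < n)%N -> (#|parab k.+1| <= k.+1.*2 * #|parab k|)%N.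
Proof.
move=> ltkn.
pose U := [set coset_rep x.1 * x.2 | x in setX [set: bool * 'I_k.+1] (parab k)].
have U_gen i x : (i <= k)%N -> x \in U -> t i * x \in U.
  move=> leik /imsetP[[p g]]; rewrite inE /= => /andP[_ gk] ->.
  have [q [h hk eq_q]] := coset_rep_step p ltkn leik.
  by rewrite mulgA eq_q -mulgA (imset_f (fun x => _ x.1 * x.2) (x := (q, h * g))) // !inE groupM.
have U1 : 1 \in U.
  apply/imsetP; exists ((false, ord_max), 1); first by rewrite !inE group1.
  by rewrite /coset_rep /= subnn mulg1.
have sub_U : parab k.+1 \subset U.
  apply/subsetP => x /gen_prodgP[m [c c_in ->]].
  elim: m c c_in => [|m IHm] c c_in; first by rewrite big_ord0.
  rewrite big_ord_recl; have /imsetP[i _ ->] := c_in ord0.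
  by apply: U_gen; [rewrite -ltnS | apply: IHm].
apply: leq_trans (subset_leq_card sub_U) _; apply: leq_trans (leq_imset_card _ _) _.
by rewrite cardsX cardsT card_prod card_bool card_ord mul2n.
Qed.

Lemma card_parab_le k : (k <= n)%N -> (#|parab k| <= 2 ^ k * k`!)%N.
Proof.
elim: k => [_|k IHk ltkn].
  suff /trivgP -> : parab 0 \subset [1] by rewrite cards1.
  by rewrite gen_subG; apply/subsetP => x /imsetP[[]].
apply: leq_trans (card_parabS ltkn) _; rewrite expnS factS -mul2n.
by rewrite mulnACA leq_mul2l (IHk (ltnW ltkn)) orbT.
Qed.

End UpperBound.

(** * Signed permutations and the lower bound *)

Section SignedPermutations.

Variable n : nat.

(* The signed permutations of n + 1 coordinates, as the permutations of the   *)
(* positions 0, ..., 2n + 1 commuting with p |-> 2n + 1 - p; sflip n is the    *)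
(* sign change, since its two transpositions coincide.                        *)
Definition sflip (i p : nat) : nat :=
  if p == i then i.+1 else if p == i.+1 then i
  else if p == n.*2.+1 - i then n.*2 - i
  else if p == n.*2 - i then n.*2.+1 - i else p.

Variant sflip_spec i p : nat -> Prop :=
| SflipL of p = i : sflip_spec i p i.+1
| SflipR of p = i.+1 : sflip_spec i p i
| SflipOppL of i < n & p = n.*2.+1 - i : sflip_spec i p (n.*2 - i)
| SflipOppR of i < n & p = n.*2 - i : sflip_spec i p (n.*2.+1 - i)
| SflipId of p <> i & p <> i.+1 & p <> n.*2.+1 - i & p <> n.*2 - i : sflip_spec i p p.

Lemma sflipP i p : i <= n -> sflip_spec i p (sflip i p).
Proof.
move=> lein; rewrite /sflip.
case: eqP => [?|?]; first exact: SflipL.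
case: eqP => [?|?]; first exact: SflipR.
case: eqP => [?|?]; first by apply: SflipOppL; lia.
case: eqP => [?|?]; first by apply: SflipOppR; lia.
exact: SflipId.
Qed.

Ltac sflip_cases :=
  repeat match goal with
  | H : context [sflip _ _] |- _ => move: H
  | |- context [sflip ?i ?p] =>
    lazymatch p with
    | context [sflip _ _] => fail
    | _ => (case: (@sflipP i p); first lia); intros; try (exfalso; lia)
    end
  end; try lia.

Lemma sflipK i : i <= n -> involutive (sflip i).
Proof. by move=> lein p; sflip_cases. Qed.

Lemma sflip_ltn i p : i <= n -> p < n.*2.+2 -> sflip i p < n.*2.+2.
Proof. by move=> lein ltp; sflip_cases. Qed.

Definition sflip_ord (i : 'I_n.+1) (p : 'I_n.*2.+2) : 'I_n.*2.+2 :=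
  Ordinal (sflip_ltn (ltn_ord i) (ltn_ord p)).

Lemma sflip_ordK i : involutive (sflip_ord i).
Proof. by move=> p; apply: val_inj; rewrite /= sflipK // -ltnS. Qed.

Definition sperm (i : 'I_n.+1) : 'S_n.*2.+2 := perm (can_inj (sflip_ordK i)).

Lemma spermE i p : sperm i p = sflip i p :> nat.
Proof. by rewrite permE. Qed.

Local Open Scope group_scope.

Lemma sperm_sqr i : sperm i * sperm i = 1.
Proof.
apply/permP => p; rewrite permM perm1; apply: val_inj.
by rewrite /= !spermE sflipK // -ltnS.
Qed.

Lemma sperm_rel i j : (sperm i * sperm j) ^+ coxeter_matrix_C i j = 1.
Proof.
wlog leij : i j / i <= j => [IH|].
  have [/IH //|/ltnW/IH] := leqP i j.
  rewrite (_ : coxeter_matrix_C j i = coxeter_matrix_C i j).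
    move/(congr1 inv); rewrite -expVgn invMg invg1.
    by rewrite !(mulg1_eq (sperm_sqr _)).
  by rewrite /coxeter_matrix_C eq_sym orbC maxnC.
rewrite /coxeter_matrix_C; case: eqP => [<-|/eqP neq_ij]; first by rewrite expg1 sperm_sqr.
have {neq_ij} neq_ij : i <> j :> nat by apply/eqP.
have lejn : j <= n by rewrite -ltnS.
rewrite (maxn_idPr leij) /=; case: ifP => [adj|/negbT nadj]; first case: eqP => [jn|njn].
all: apply/permP => p; rewrite perm1 !expgS expg0 mulg1 !permM.
all: apply: val_inj => /=; rewrite !spermE.
- sflip_cases.
- sflip_cases.
- sflip_cases.
Qed.

Lemma sperm_inj : injective sperm.
Proof.
move=> i j /(congr1 (fun p : 'S_n.*2.+2 => nat_of_ord (p (inord i)))).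
have [lein lejn] : (i <= n)%N /\ (j <= n)%N by rewrite -ltnS -[(j <= n)%N]ltnS.
rewrite !spermE inordK; last by lia.
by move=> eq_ij; apply: val_inj; move: eq_ij => /=; sflip_cases.
Qed.

Lemma sperm_adj_neq (i j : 'I_n.+1) : i.+1 = j ->
  sperm i * sperm j <> sperm j * sperm i.
Proof.
move=> def_j /(congr1 (fun p : 'S_n.*2.+2 => nat_of_ord (p (inord i)))).
have lejn : (j <= n)%N by rewrite -ltnS.
by rewrite !permM !spermE inordK; [sflip_cases | lia].
Qed.

(** The last k generators, at the end of the bond 4, so that each stage is again of type C. *)
Definition sperm_parab k : {group 'S_n.*2.+2} :=
  <<[set sperm i | i : 'I_n.+1 & (n.+1 - k <= i)%N]>>.

(** Orbit-stabilizer at position n - k: its orbit contains the 2(k + 1) central positions, and its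
    stabilizer contains the previous subgroup. *)
Lemma card_sperm_parabS k : (k <= n)%N ->
  (k.+1.*2 * #|sperm_parab k| <= #|sperm_parab k.+1|)%N.
Proof.
move=> lekn; pose x : 'I_n.*2.+2 := inord (n - k)%N.
have xE : x = (n - k)%N :> nat by rewrite inordK; lia.
rewrite -(card_orbit_stab 'P (sperm_parab k.+1) x) leq_mul //; last first.
  apply/subset_leq_card; rewrite gen_subG; apply/subsetP => y /imsetP[i].
  rewrite inE => lei ->; rewrite inE mem_gen; last first.
    by apply/imsetP; exists i; rewrite // inE; lia.
  have lein : (i <= n)%N by rewrite -ltnS.
  apply/astab1P; apply: val_inj; rewrite /= apermE spermE xE.
  by sflip_cases.
have reach d : (d < k.+1.*2)%N -> inord (n - k + d)%N \in orbit 'P (sperm_parab k.+1) x.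
  elim: d => [_|d IHd ltd]; first by rewrite addn0 orbit_refl.
  pose p : 'I_n.*2.+2 := inord (n - k + d)%N.
  have pE : p = (n - k + d)%N :> nat by rewrite inordK; lia.
  (* The generator moving position n - k + d one step to the right, through its mirror transposition
     in the right half. *)
  pose i : 'I_n.+1 := inord (if n - k + d <= n then n - k + d else n.*2 - (n - k + d))%N.
  have iE : i = (if n - k + d <= n then n - k + d else n.*2 - (n - k + d))%N :> nat.
    by rewrite inordK //; case: ifP; lia.
  have lein : (i <= n)%N by rewrite -ltnS.
  have i_in : sperm i \in sperm_parab k.+1.
    by rewrite mem_gen // imset_f // inE iE; case: ifP; lia.
  apply: orbit_trans (IHd (ltnW ltd)).
  apply/orbitP; exists (sperm i) => //; apply: val_inj.
  rewrite /= apermE spermE -/p pE inordK; last by lia.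
  by move: lein; rewrite iE; case: ifP => ? ?; sflip_cases.
rewrite -[X in (X <= _)%N]card_ord.
rewrite -(card_imset _ (f := fun d : 'I_k.+1.*2 => inord (n - k + d)%N : 'I_n.*2.+2)).
  by apply/subset_leq_card/subsetP => _ /imsetP[d _ ->]; apply: reach.
move=> d e /(congr1 (@nat_of_ord _)); have := ltn_ord d; have := ltn_ord e.
by move=> lte ltd; rewrite !inordK; try lia; move=> eq_de; apply: val_inj => /=; lia.
Qed.

Lemma leq_card_sperm_parab k : (k <= n.+1)%N -> (2 ^ k * k`! <= #|sperm_parab k|)%N.
Proof.
elim: k => [_|k IHk lekn]; first exact: cardG_gt0.
apply: leq_trans (card_sperm_parabS lekn); rewrite expnS factS -mul2n.
by rewrite mulnACA leq_mul2l (IHk (ltnW lekn)) orbT.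
Qed.

End SignedPermutations.

(** * Specialization to type C *)

Section TypeC.

Local Open Scope group_scope.

Variables (n : nat) (W : finGroupType) (s : 'I_n.+1 -> W).
Hypothesis cs : coxeter_system (@coxeter_matrix_C n.+1) s.

Lemma coxeter_matrix_C_diag (i : 'I_n.+1) : coxeter_matrix_C i i = 1%N.
Proof. by rewrite /coxeter_matrix_C eqxx. Qed.

Lemma sperm_morph : exists2 f : W -> 'S_n.*2.+2,
  {morph f : x y / x * y} & forall i, f (s i) = sperm i.
Proof.
have [f fs] := cox_univ cs (@sperm_rel n).
by exists f => // x y; rewrite gmulfM.
Qed.

Lemma genC_inj : injective s.
Proof. by have [f _ fs] := sperm_morph => i j /(congr1 f); rewrite !fs => /sperm_inj. Qed.

Let ss := gen_sqr coxeter_matrix_C_diag cs.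
Let sV := gen_invg coxeter_matrix_C_diag cs.

(** The relations give commutation of distant generators; non-commutation of neighbours is detected
    in the image by signed permutations. *)
Lemma genC_commuteE i j : (s i * s j == s j * s i) = (i.+1 != j :> nat) && (j.+1 != i :> nat).
Proof.
apply/eqP/andP => [com | [ij ji]].
  have [f fM fs] := sperm_morph; move/(congr1 f): com; rewrite !fM !fs => com.
  by split; apply/eqP => adj; have := sperm_adj_neq adj; rewrite com.
have := cox_rel cs i j; rewrite /coxeter_matrix_C (negPf ij) (negPf ji) /=.
case: eqP => [->//|_]; rewrite expgS expg1 => /mulg1_eq <-.
by rewrite invMg !sV.
Qed.

Lemma commutingC k :
  [set J : {set 'I_n.+1} | commuting s J & #|J| == k] = sparse_below n.+1 n.+1 k.
Proof.
apply/setP => J; apply/idP/sparse_belowP => [|[_ J2 kJ]]; rewrite inE.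
  case/andP=> /forall_inP cJ /eqP kJ; split=> // i j iJ jJ.
  have /forall_inP/(_ j jJ) := cJ i iJ.
  by rewrite genC_commuteE => /andP[/eqP].
rewrite kJ eqxx andbT; apply/forall_inP => i iJ; apply/forall_inP => j jJ.
by rewrite genC_commuteE; apply/andP; split; apply/eqP; apply: J2.
Qed.

(** The universal property maps W onto the group of all the [sperm i]. *)
Lemma card_typeC_ge : (2 ^ n.+1 * n.+1`! <= #|W|)%N.
Proof.
apply: leq_trans (leq_card_sperm_parab (leqnn _)) _.
have [f fM fs] := sperm_morph.
rewrite -cardsT; apply: leq_trans (leq_imset_card f _).
apply/subset_leq_card/subsetP => x /gen_prodgP[m [c c_in ->]].
elim: m c c_in => [|m IHm] c c_in.
  rewrite big_ord0; apply/imsetP; exists 1; rewrite ?inE //.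
  by apply: (mulgI (f 1)); rewrite -fM !mulg1.
rewrite big_ord_recl; have /imsetP[i _ ->] := c_in ord0.
have /imsetP[w _ ->] : \prod_(j < m) c (lift ord0 j) \in f @: [set: W] by apply: IHm.
by rewrite -fs -fM imset_f ?inE.
Qed.

Lemma genC_braid (i j : 'I_n.+1) : (i.+1 == j :> nat) || (j.+1 == i :> nat) ->
  (maxn i j < n)%N -> s i * s j * s i = s j * s i * s j.
Proof.
move=> adj ltn; have := cox_rel cs i j; rewrite /coxeter_matrix_C adj.
rewrite (ltn_eqF ltn); case: eqP => [->//|_].
rewrite !expgS expg0 mulg1 => rel3.
have /mulg1_eq : s i * s j * s i * (s j * s i * s j) = 1 by rewrite -rel3 !mulgA.
by rewrite !invMg !sV mulgA => ->.
Qed.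

Lemma genC_braid4 (i j : 'I_n.+1) : (i.+1 == j :> nat) || (j.+1 == i :> nat) ->
  maxn i j = n -> s i * s j * s i * s j = s j * s i * s j * s i.
Proof.
move=> adj eqn; have := cox_rel cs i j; rewrite /coxeter_matrix_C adj eqn eqxx.
case: eqP => [->//|_]; rewrite !expgS expg0 mulg1 => rel4.
have /mulg1_eq : s i * s j * s i * s j * (s i * s j * s i * s j) = 1.
  by rewrite -rel4 !mulgA.
by rewrite !invMg !sV !mulgA => ->.
Qed.

Lemma card_typeC_le : (#|W| <= 2 ^ n.+1 * n.+1`!)%N.
Proof.
(* Reversing the numbering puts the bond 4 between [t 0] and [t 1]. *)
pose t i := s (inord (n - i)).
have iE i : (inord (n - i) : 'I_n.+1) = (n - i)%N :> nat by rewrite inordK //; lia.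
have -> : #|W| = #|parab t n.+1|.
  rewrite -cardsT; apply: eq_card => w; rewrite inE; apply/esym.
  have [r ->] := cox_gen cs w.
  apply: group_prod => i _; rewrite (_ : s i = t (n - i)%N) ?mem_parab //; first lia.
  by congr s; apply: val_inj; rewrite /= iE; have := ltn_ord i; lia.
apply: (card_parab_le (n := n.+1)) => // [i _|i j lt_ij|i i0 lti|lt1].
- exact: ss.
- by apply/eqP; rewrite genC_commuteE !iE; apply/andP; split; apply/eqP; lia.
- by apply: genC_braid; rewrite !iE; lia.
by apply: genC_braid4; rewrite !iE; lia.
Qed.

Lemma card_typeC : #|W| = (2 ^ n.+1 * n.+1`!)%N.
Proof. by apply/eqP; rewrite eqn_leq card_typeC_le card_typeC_ge. Qed.

End TypeC.

Theorem theorem3p8 (n k : nat) (hn : (2 <= n)%N) (hk : (k <= n)%N)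
    (W : finGroupType) (s : 'I_n -> W)
    (cs : coxeter_system (@coxeter_matrix_C n) s) :
  #|boolean_intervals cs k| = (2 ^ (n - k) * n`! * 'C(n + 1 - k, k))%N.
Proof.
case: n hn hk s cs => // n _ hk s cs.
have diag := @coxeter_matrix_C_diag n.
have [N [N_gen N_mul]] := inversion_cocycle_exists diag cs.
have := card_boolean_intervals diag cs N_gen N_mul (genC_inj cs) k.
rewrite (commutingC cs) card_sparse_below // (card_typeC cs) addn1.
have -> : (2 ^ n.+1 = 2 ^ (n.+1 - k) * 2 ^ k)%N by rewrite -expnD subnK.
move=> eq_card; apply/eqP; rewrite -(eqn_pmul2r (_ : 0 < 2 ^ k)%N) ?expn_gt0 //.
by rewrite eq_card mulnC (mulnAC _ (2 ^ k)%N) mulnAC.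
Qed.
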